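(* Let $f_1,\dots,f_m\in\mathbb{Z}[x_1,\dots,x_d]$. There exists $\mathbf{n}\in\mathbb{R}^d$ such that $\{f_i\}_{i\in\{1,\dots,m\}}$ has a positive vertex cluster with respect to $\mathbf{n}$ if and only if the formula $\bigwedge_{i=1}^m\psi(f_i,\mathbf{n},c_i)$ is satisfiable, i.e., there exist $\mathbf{n}\in\mathbb{R}^d$ and $c_1,\dots,c_m\in\mathbb{R}$ making it true, where $$\psi(f,\mathbf{n},c)\;=\;\Big[\bigvee_{\mathbf{p}\in\operatorname{frame}^+(f)}\mathbf{n}^T\mathbf{p}+c>0\Big]\wedge\Big[\bigwedge_{\mathbf{q}\in\operatorname{frame}^-(f)}\mathbf{n}^T\mathbf{q}+c<0\Big].$$
   Context: For $f=\sum_{\mathbf{p}\in F}f_\mathbf{p}\mathbf{x}^\mathbf{p}$ with $f_\mathbf{p}\neq0$ and $F\subset\mathbb{N}^d$ finite, $\operatorname{frame}(f)=F$, $\operatorname{frame}^+(f)=\{\mathbf{p}\in F\mid f_\mathbf{p}>0\}$, $\operatorname{frame}^-(f)=\{\mathbf{p}\in F\mid f_\mathbf{p}<0\}$. An empty disjunction is false and an empty conjunction is true. A point $\mathbf{p}$ is a vertex of $\operatorname{conv}(S)$ with respect to $\mathbf{n}$ if $\mathbf{n}^T\mathbf{p}>\mathbf{n}^T\mathbf{q}$ for all $\mathbf{q}\in\operatorname{conv}(S)\setminus\{\mathbf{p}\}$. A tuple $(\mathbf{p}_1,\dots,\mathbf{p}_m)$ is a positive vertex cluster of $\{f_i\}_i$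 with respect to $\mathbf{n}$ if for every $i$, $\mathbf{p}_i\in\operatorname{frame}^+(f_i)$ and $\mathbf{p}_i$ is a vertex of $\operatorname{conv}(\operatorname{frame}(f_i))$ with respect to $\mathbf{n}$. *)

(* Defs.v *)
From mathcomp Require Import all_boot all_order all_algebra.
From mathcomp Require Import classical_sets reals.
From mathcomp Require Import mpoly.

Set Implicit Arguments.
Unset Strict Implicit.
Unset Printing Implicit Defensive.

Import Order.TTheory GRing.Theory Num.Theory.
Local Open Scope ring_scope.
Local Open Scope classical_set_scope.

Definition frame (d : nat) (f : {mpoly int[d]}) : seq 'X_{1..d} := msupp f.

Definition frame_pos (d : nat) (f : {mpoly int[d]}) : seq 'X_{1..d} :=
  [seq p <- frame f | 0 < f@_p].

Definition frame_neg (d : nat) (f : {mpoly int[d]}) : seq 'X_{1..d} :=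
  [seq p <- frame f | f@_p < 0].

Definition dot (R : realType) (d : nat) (u v : 'cV[R]_d) : R :=
  (u^T *m v) 0 0.

(* The exponent vector of a monomial, seen as a point of R^d. *)
Definition point (R : realType) (d : nat) (p : 'X_{1..d}) : 'cV[R]_d :=
  \col_(i < d) (p i)%:R.

Definition conv_hull (R : realType) (d : nat) (S : set 'cV[R]_d) :
    set 'cV[R]_d :=
  [set x | exists (k : nat) (w : 'I_k -> R) (s : 'I_k -> 'cV[R]_d),
     [/\ forall i, 0 <= w i,
         \sum_i w i = 1,
         forall i, S (s i) &
         x = \sum_i w i *: s i]].

(* Membership of p in conv_hull S is not required here; for a positive vertex
   cluster it follows from p being in the frame. *)
Definition is_vertex (R : realType) (d : nat) (S : set 'cV[R]_d)
    (n p : 'cV[R]_d) : Prop :=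
  forall q, (conv_hull S `\ p) q -> dot n q < dot n p.

Definition positive_vertex_cluster (R : realType) (d m : nat)
    (f : 'I_m -> {mpoly int[d]}) (n : 'cV[R]_d)
    (p : 'I_m -> 'X_{1..d}) : Prop :=
  forall i : 'I_m,
    p i \in frame_pos (f i) /\
    is_vertex [set point R q | q in [set` frame (f i)]] n (point R (p i)).

Definition psi (R : realType) (d : nat) (f : {mpoly int[d]})
    (n : 'cV[R]_d) (c : R) : bool :=
  has (fun p => dot n (point R p) + c > 0) (frame_pos f) &&
  all (fun q => dot n (point R q) + c < 0) (frame_neg f).

(* Main.v *)
(** A vertex strictly dominates the other points of its frame, so a threshold [- c]
    fits just below it. Conversely, the formula is an open condition on [n], so [n]
    may be perturbed to take distinct values at distinct points of each frame: if
    [n^T v = 0] for a difference [v] of two points, replace [n] by [n + t v] with [t]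
    small, which makes this value [t |v|^2 > 0] without disturbing the strict
    inequalities already obtained. For a generic [n] the maximiser over each frame is
    unique, hence a vertex, and the formula forces its coefficient to be positive. *)
Require Import Defs.
From mathcomp Require Import all_boot all_order all_algebra.
From mathcomp Require Import classical_sets reals.
From mathcomp Require Import mpoly lra.

Local Open Scope ring_scope.

(* [classical_sets] also exports a [point]. *)
Import Defs.
Import Order.TTheory GRing.Theory Num.Theory.

Lemma dotDl (R : realType) (d : nat) (u v w : 'cV[R]_d) :
  dot (u + v) w = dot u w + dot v w.
Proof. by rewrite /dot linearD /= mulmxDl mxE. Qed.

Lemma dotZl (R : realType) (d : nat) (a : R) (u v : 'cV[R]_d) :
  dot (a *: u) v = a * dot u v.
Proof. by rewrite /dot linearZ /= -scalemxAl mxE. Qed.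

Lemma dotBr (R : realType) (d : nat) (u v w : 'cV[R]_d) :
  dot u (v - w) = dot u v - dot u w.
Proof. by rewrite /dot mulmxBr !mxE. Qed.

Lemma dotNr (R : realType) (d : nat) (u v : 'cV[R]_d) : dot u (- v) = - dot u v.
Proof. by rewrite /dot mulmxN mxE. Qed.

Lemma dot_sumr (R : realType) (d : nat) (I : finType) (u : 'cV[R]_d)
    (w : I -> R) (s : I -> 'cV[R]_d) :
  dot u (\sum_i w i *: s i) = \sum_i w i * dot u (s i).
Proof.
rewrite /dot mulmx_sumr summxE; apply: eq_bigr => i _.
by rewrite -scalemxAr mxE.
Qed.

Lemma dot_gt0 (R : realType) (d : nat) (v : 'cV[R]_d) : v != 0 -> 0 < dot v v.
Proof.
move=> v0.
have dotE : dot v v = \sum_i v i 0 ^+ 2.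
  by rewrite /dot mxE; apply: eq_bigr => i _; rewrite mxE.
have ge0 : 0 <= dot v v by rewrite dotE sumr_ge0 // => i _; exact: sqr_ge0.
rewrite lt_def ge0 andbT; apply: contraNneq v0 => /eqP.
rewrite dotE psumr_eq0 => [/allP h|i _]; last exact: sqr_ge0.
apply/eqP/colP => i; rewrite mxE; apply/eqP.
by have := h i (mem_index_enum i); rewrite sqrf_eq0.
Qed.

Lemma point_inj (R : realType) (d : nat) : injective (@point R d).
Proof.
move=> p q /colP e; apply/mnmP => i; have := e i.
by rewrite !mxE => /eqP; rewrite eqr_nat => /eqP.
Qed.

(** Each positive [F x] tolerates every small enough [t], and a finite list allows the minimum of
    these bounds. *)
Lemma small_perturbation (R : realType) (T : eqType) (F G : T -> R) (s : seq T) :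
  exists2 e : R, 0 < e &
    forall t x, 0 < t <= e -> x \in s -> 0 < F x -> 0 < F x + t * G x.
Proof.
elim: s => [|y s [e e0 IH]]; first by exists 1.
(* The [+ 1] avoids division by zero and keeps the conclusion strict:
   [t * |G y| <= F y - t < F y]. *)
pose e1 := if 0 < F y then F y / (`|G y| + 1) else 1.
have G1 : 0 < `|G y| + 1 by have := normr_ge0 (G y); lra.
have e10 : 0 < e1 by rewrite /e1; case: ifP => // Fy; rewrite divr_gt0.
exists (Num.min e e1) => [|t x]; first by rewrite lt_min e0.
rewrite le_min => /and3P[t0 te te1]; rewrite inE => /predU1P[->|xs Fx]; last first.
  by apply: IH => //; rewrite t0.
move=> Fy; move: te1; rewrite /e1 Fy ler_pdivlMr // => h.
have : - (t * G y) <= t * `|G y|.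
  by rewrite -mulrN ler_wpM2l ?(ltW t0) // -normrN ler_norm.
lra.
Qed.

(** A pair in [S] encodes an affine strict inequality in the direction; those that hold at [n] must
    survive. *)
Lemma generic_perturbation (R : realType) (d : nat) (vs : seq 'cV[R]_d)
    (S : seq ('cV[R]_d * R)) (n : 'cV[R]_d) :
  exists2 n' : 'cV[R]_d,
    (forall v, v \in vs -> v != 0 -> dot n' v != 0) &
    (forall x, x \in S -> 0 < dot n x.1 + x.2 -> 0 < dot n' x.1 + x.2).
Proof.
elim: vs S n => [|v vs IH] S n; first by exists n.
have [n1 n1v n1S] : exists2 n1 : 'cV[R]_d, (v != 0 -> dot n1 v != 0) &
    (forall x, x \in S -> 0 < dot n x.1 + x.2 -> 0 < dot n1 x.1 + x.2).
  have [nv|nv] := eqVneq (dot n v) 0; last by exists n.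
  have [e e0 eS] := small_perturbation _ _ (fun x => dot n x.1 + x.2)
    (fun x : 'cV[R]_d * R => dot v x.1) S.
  exists (n + e *: v) => [v0|x xS nx].
    by rewrite dotDl dotZl nv add0r mulf_neq0 ?gt_eqF ?dot_gt0.
  by rewrite dotDl dotZl addrAC eS // e0 lexx.
(* The two added constraints freeze the sign of [dot n1 v], so later perturbations cannot make it
   vanish. *)
have [n' n'vs n'S] := IH [:: (v, 0), (- v, 0) & S] n1.
exists n' => [w|x xS nx]; last by rewrite n'S ?inE ?xS ?orbT // n1S.
rewrite inE => /predU1P[->|]; last exact: n'vs.
move=> /n1v; rewrite !neq_lt => /orP[n1v_lt0|n1v_gt0].
- have := n'S (- v, 0); rewrite !inE eqxx orbT => /(_ isT) /=.
  by rewrite !dotNr !addr0 !oppr_gt0 => ->.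
- have := n'S (v, 0); rewrite !inE eqxx => /(_ isT) /=.
  by rewrite !addr0 => ->; rewrite ?orbT.
Qed.

Lemma exists_argmax (R : realType) (T : eqType) (F : T -> R) (s : seq T) (x0 : T) :
  x0 \in s -> exists2 x, x \in s & forall y, y \in s -> F y <= F x.
Proof.
elim: s x0 => // y [|z s] IH x0 _.
  by exists y => [|x]; rewrite !inE // => /eqP ->.
have [x xs xmax] := IH z (mem_head _ _).
have [yx|/ltW xy] := leP (F y) (F x).
  exists x => [|w]; first by rewrite inE xs orbT.
  by rewrite inE => /predU1P[->|/xmax].
exists y => [|w]; first exact: mem_head.
by rewrite inE => /predU1P[->|/xmax /le_trans ->].
Qed.

Lemma subset_conv_hull (R : realType) (d : nat) (S : set 'cV[R]_d) :
  subset S (conv_hull S).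
Proof.
move=> x Sx; exists 1, (fun=> 1), (fun=> x); split=> //; first by rewrite big_ord1.
by rewrite big_ord1 scale1r.
Qed.

(** The difference of [p] and a convex combination is the same combination of the [p - s i], each
    with nonnegative value under [n]. If the total is zero, every term with nonzero weight has
    [s i = p], so the combination is [p] itself. *)
Lemma strict_max_is_vertex (R : realType) (d : nat) (S : set 'cV[R]_d)
    (n p : 'cV[R]_d) :
  (forall q, S q -> q != p -> dot n q < dot n p) -> is_vertex S n p.
Proof.
move=> pmax x [[k [w [s [w0 w1 Ss ->]]]] /= xp].
have Dp : p - \sum_i w i *: s i = \sum_i w i *: (p - s i).
  rewrite -[p in LHS]scale1r -w1 scaler_suml -sumrB.
  by apply: eq_bigr => i _; rewrite scalerBr.
have ge0 i : 0 <= w i * dot n (p - s i).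
  rewrite mulr_ge0 // dotBr subr_ge0.
  by have [->//|/(pmax _ (Ss i))/ltW] := eqVneq (s i) p.
rewrite -subr_gt0 -dotBr Dp dot_sumr lt_def sumr_ge0 ?andbT; last by move=> i _.
apply/negP; rewrite psumr_eq0 => [/allP h|i _]; last exact: ge0.
apply: xp; apply/esym/eqP; rewrite -subr_eq0 Dp big1 // => i _.
have := h i (mem_index_enum i); rewrite /= mulf_eq0 => /orP[/eqP ->|].
  by rewrite scale0r.
rewrite dotBr subr_eq0; have [->|/(pmax _ (Ss i))] := eqVneq (s i) p.
  by rewrite subrr scaler0.
by move=> lt /eqP e; rewrite e ltxx in lt.
Qed.

Lemma vertex_psi (R : realType) (d : nat) (f : {mpoly int[d]})
    (n : 'cV[R]_d) (p : 'X_{1..d}) :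
  p \in frame_pos f ->
  is_vertex [set point R q | q in [set` frame f]]%classic n (point R p) ->
  exists c : R, psi f n c.
Proof.
move=> pf pv.
(* With slope [-1], [e] lies strictly below every positive gap between [p] and a negative frame
   point, so the threshold [dot n (point R p) - e] separates them. *)
have [e e0 he] := small_perturbation _ _
  (fun q => dot n (point R p) - dot n (point R q)) (fun=> -1) (frame_neg f).
exists (e - dot n (point R p)); apply/andP; split.
  by apply/hasP; exists p => //; lra.
apply/allP => q qf.
have := he e q; rewrite e0 lexx qf => /(_ isT isT).
suff : dot n (point R q) < dot n (point R p) by move=> lt /(_ _); lra.
move: qf pf; rewrite !mem_filter => /andP[q0 qf] /andP[p0 _]; apply: pv; split.
  by apply: subset_conv_hull; exists q.
by move=> /= /point_inj qp; move: q0; rewrite qp ltNge ltW.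
Qed.

Lemma psi_vertex (R : realType) (d : nat) (f : {mpoly int[d]})
    (n : 'cV[R]_d) (c : R) :
  {in frame f &, injective (fun p => dot n (point R p))} ->
  psi f n c ->
  exists p, p \in frame_pos f /\
    is_vertex [set point R q | q in [set` frame f]]%classic n (point R p).
Proof.
move=> inj /andP[/hasP[p0]]; rewrite mem_filter => /andP[_ p0f] p0c /allP neg.
have [p pf pmax] := exists_argmax _ _ (fun p => dot n (point R p)) _ _ p0f.
exists p; split; last first.
  apply: strict_max_is_vertex => _ [q /= qf <-] qp.
  rewrite lt_neqAle pmax // andbT; apply: contraNneq qp => e.
  by rewrite (inj q p).
(* A zero coefficient contradicts membership in the support; a negative one would put the maximum
   below [- c], while [p0] already lies above it. *)
rewrite mem_filter pf andbT ltNge le_eqVlt; apply/negP => /orP[/eqP fp|fp].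
  by move: pf; rewrite mcoeff_msupp fp eqxx.
have := neg p; rewrite mem_filter fp pf => /(_ isT); have := pmax p0 p0f; lra.
Qed.

Lemma psi_generic (R : realType) (d m : nat) (f : 'I_m -> {mpoly int[d]})
    (n : 'cV[R]_d) (c : 'I_m -> R) :
  (forall i, psi (f i) n (c i)) ->
  exists2 n' : 'cV[R]_d,
    (forall i, {in frame (f i) &, injective (fun p => dot n' (point R p))}) &
    (forall i, psi (f i) n' (c i)).
Proof.
move=> nc.
pose pts := flatten [seq frame (f i) | i <- enum 'I_m].
have ptsP i p : p \in frame (f i) -> p \in pts.
  by move=> pf; apply/flatten_mapP; exists i => //; rewrite mem_enum.
(* Pooling all frames lets one direction serve every polynomial at once. *)
pose vs := [seq point R p - point R q | p <- pts, q <- pts].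
(* The negated pairs turn the upper bounds of [psi] into positivity constraints. Pairs whose
   inequality fails at [n] impose nothing. *)
pose S := [seq (point R p, c i) | p <- pts, i <- enum 'I_m] ++
          [seq (- point R p, - c i) | p <- pts, i <- enum 'I_m].
have [n' n'vs n'S] := generic_perturbation _ _ vs S n.
exists n' => i.
  move=> p q /ptsP pf /ptsP qf /eqP; rewrite -subr_eq0 -dotBr => pq.
  apply: (@point_inj R); apply/eqP; rewrite -subr_eq0; apply: contraLR pq.
  by apply: n'vs; apply: allpairs_f.
have /andP[/hasP[p pf pc] /allP neg] := nc i; apply/andP; split.
  apply/hasP; exists p => //; apply: (n'S (point R p, c i)) => //.
  rewrite mem_cat allpairs_f ?mem_enum //; apply: (ptsP i).
  by move: pf; rewrite mem_filter => /andP[].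
apply/allP => q qf; have qc := neg q qf.
have := n'S (- point R q, - c i); rewrite /= !dotNr -!opprD !oppr_gt0; apply=> //.
rewrite mem_cat orbC allpairs_f ?mem_enum //; apply: (ptsP i).
by move: qf; rewrite mem_filter => /andP[].
Qed.

Theorem theorem2 (R : realType) (d m : nat) (f : 'I_m -> {mpoly int[d]}) :
  (exists (n : 'cV[R]_d) (p : 'I_m -> 'X_{1..d}),
      positive_vertex_cluster f n p) <->
  (exists (n : 'cV[R]_d) (c : 'I_m -> R),
      forall i : 'I_m, psi (f i) n (c i)).
Proof.
split=> [[n [p np]]|[n [c /psi_generic[n' inj n'c]]]].
  have /fin_all_exists[c nc] i : exists c, psi (f i) n c.
    by have [pf pv] := np i; apply: vertex_psi pf pv.
  by exists n, c.
have /fin_all_exists[p n'p] i := psi_vertex _ _ _ _ _ (inj i) (n'c i).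
by exists n', p.
Qed.
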